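(* $(\mathfrak h_3\oplus\mathbb R,S_0^1,J)$ is neither a first kind nor a second kind algebraic Ricci soliton with respect to $\nabla^1$: there do not exist $c\in\mathbb R$ and a derivation $D$ of $\mathfrak h_3\oplus\mathbb R$ with $\operatorname{Ric}^1=c\operatorname{Id}+D$, and there do not exist $c\in\mathbb R$ and a derivation $D$ of $\mathfrak h_3\oplus\mathbb R$ with $\widetilde{\operatorname{Ric}}^1=c\operatorname{Id}+D$.
   Context: $\mathfrak h_3\oplus\mathbb R$ is the real Lie algebra with basis $e_1,e_2,e_3,e_4$ and only non-zero bracket (up to skew-symmetry) $[e_1,e_2]=e_3$. $S_0^1$ is the Lorentzian inner product $\langle\cdot,\cdot\rangle$ whose matrix in $(e_1,e_2,e_3,e_4)$ is $\begin{bmatrix}1&0&0&0\\0&1&0&0\\0&0&0&1\\0&0&1&0\end{bmatrix}$. Fix the basis $v_1=e_1$, $v_2=e_2$, $v_3=\frac1{\sqrt2}(e_3+e_4)$, $v_4=\frac1{\sqrt2}(e_3-e_4)$, which is orthonormal: $\langle v_i,v_j\rangle=0$ for $i\ne j$, $\langle v_i,v_i\rangle=1$ for $i=1,2,3$, $\langle v_4,v_4\rangle=-1$. The product structure $J$ is the linear map with $Jv_i=v_i$ for $i=1,2,3$ and $Jv_4=-v_4$. Write $\mathfrak g$ for the Lie algebra. The Levi-Civita connection is the bilinear map $\nabla:\mathfrak g\times\mathfrak g\to\mathfrak g$ with $2\langle\nabla_uv,w\rangle=\langle[u,v],w\rangle+\langle[w,u],v\rangle+\langle[w,v],u\rangle$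 for all $u,v,w$. Put $(\nabla_uJ)v=\nabla_u(Jv)-J(\nabla_uv)$. The canonical connection is $\nabla^0_uv=\nabla_uv-\frac12(\nabla_uJ)Jv$, and the Kobayashi-Nomizu connection is $\nabla^1_uv=\nabla^0_uv-\frac14\left[(\nabla_vJ)Ju-(\nabla_{Jv}J)u\right]$. The curvature of $\nabla^1$ is $R^1_{uv}w=\nabla^1_{[u,v]}w-\nabla^1_u\nabla^1_vw+\nabla^1_v\nabla^1_uw$, its Ricci operator is $\operatorname{Ric}^1(u)=\sum_{k=1}^4\langle v_k,v_k\rangle R^1_{v_ku}v_k$, and $\rho^1(u,v)=\langle\operatorname{Ric}^1(u),v\rangle$. Put $\widetilde\rho^1(u,v)=\frac12(\rho^1(u,v)+\rho^1(v,u))$ and define $\widetilde{\operatorname{Ric}}^1$ by $\langle\widetilde{\operatorname{Ric}}^1(u),v\rangle=\widetilde\rho^1(u,v)$. A derivation of $\mathfrak g$ is a linear map $D:\mathfrak g\to\mathfrak g$ with $[D(u),v]+[u,D(v)]=D[u,v]$ for all $u,v\in\mathfrak g$. *)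

(* Defs.v *)
From mathcomp Require Import all_boot all_order all_algebra.
From mathcomp Require Import reals.
From mathcomp Require Import ring.

Set Implicit Arguments.
Unset Strict Implicit.
Unset Printing Implicit Defensive.

Import Order.TTheory GRing.Theory Num.Theory.
Local Open Scope ring_scope.

Section AlgebraicRicciSolitons.

Context {R : realType} {V : lmodType R}.
Variables (br : V -> V -> V) (ip : V -> V -> R) (J : V -> V).

(* Koszul's formula on left-invariant fields; for a non-degenerate [ip] it
   determines [nabla], which is then bilinear because [br] and [ip] are. *)
Definition levi_civita (nabla : V -> V -> V) : Prop :=
  forall u v w : V,
    2 * ip (nabla u v) w = ip (br u v) w + ip (br w u) v + ip (br w v) u.

Definition derivation (D : V -> V) : Prop :=
  forall u v : V, br (D u) v + br u (D v) = D (br u v).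

Variables (nabla : V -> V -> V) (n : nat) (frame : 'I_n -> V).

(* [nablaJ u v] is $(\nabla_u J) v$. *)
Definition nablaJ (u v : V) : V := nabla u (J v) - J (nabla u v).

Definition canonical_conn (u v : V) : V :=
  nabla u v - 2^-1 *: nablaJ u (J v).

Definition kobayashi_nomizu_conn (u v : V) : V :=
  canonical_conn u v - 4^-1 *: (nablaJ v (J u) - nablaJ (J v) u).

Definition KN_curvature (u v w : V) : V :=
  kobayashi_nomizu_conn (br u v) w
  - kobayashi_nomizu_conn u (kobayashi_nomizu_conn v w)
  + kobayashi_nomizu_conn v (kobayashi_nomizu_conn u w).

Definition KN_Ric (u : V) : V :=
  \sum_k ip (frame k) (frame k) *: KN_curvature (frame k) u (frame k).

Definition KN_rho (u v : V) : R := ip (KN_Ric u) v.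

Definition KN_rho_sym (u v : V) : R := 2^-1 * (KN_rho u v + KN_rho v u).

Definition is_KN_Ric_sym (T : V -> V) : Prop :=
  forall u v : V, ip (T u) v = KN_rho_sym u v.

Definition first_kind_soliton : Prop :=
  exists (c : R) (D : {linear V -> V}),
    derivation D /\ forall u : V, KN_Ric u = c *: u + D u.

Definition second_kind_soliton : Prop :=
  exists T : V -> V, is_KN_Ric_sym T /\
    exists (c : R) (D : {linear V -> V}),
      derivation D /\ forall u : V, T u = c *: u + D u.

End AlgebraicRicciSolitons.

(* $\mathfrak h_3 \oplus \mathbb R$ is carried by row vectors, the coordinates
   being those in the basis $e_1, \dots, e_4$, which is [e 0], ..., [e 3]. *)
Section H3R.

Context {R : realType}.
Local Notation V := 'rV[R]_4.

Definition e (i : 'I_4) : V := delta_mx 0 i.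

Definition h3R_br (u v : V) : V :=
  (u 0 0 * v 0 1 - u 0 1 * v 0 0) *: e 2.

Lemma h3R_br_basis (i j : 'I_4) :
  h3R_br (e i) (e j)
  = if (i == 0) && (j == 1) then e 2
    else if (i == 1) && (j == 0) then - e 2 else 0.
Proof.
rewrite /h3R_br /e !mxE /=.
case: i => -[|[|[|[|//]]]] ?; case: j => -[|[|[|[|//]]]] ? /=;
  by rewrite ?(mulr0, mul0r, mulr1, subr0, sub0r, oppr0, scale0r, scale1r,
               scaleN1r).
Qed.

Definition S01 : 'M[R]_4 :=
  \matrix_(i < 4, j < 4)
    nth 0 (nth [::] [:: [:: 1; 0; 0; 0];
                        [:: 0; 1; 0; 0];
                        [:: 0; 0; 0; 1];
                        [:: 0; 0; 1; 0]] i) j.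

Definition S01_ip (u v : V) : R := (u *m S01 *m v^T) 0 0.

Definition vframe (i : 'I_4) : V :=
  nth 0 [:: e 0;
            e 1;
            (Num.sqrt 2)^-1 *: (e 2 + e 3);
            (Num.sqrt 2)^-1 *: (e 2 - e 3)] i.

Definition is_product_structure (J : {linear V -> V}) : Prop :=
  [/\ J (vframe 0) = vframe 0, J (vframe 1) = vframe 1,
      J (vframe 2) = vframe 2 & J (vframe 3) = - vframe 3].

Lemma S01_ipE (u v : V) :
  S01_ip u v = u 0 0 * v 0 0 + u 0 1 * v 0 1 + u 0 2 * v 0 3 + u 0 3 * v 0 2.
Proof.
rewrite /S01_ip !mxE !big_ord_recl big_ord0 !mxE !big_ord_recl !big_ord0 !mxE /=.
have E1 : lift ord0 ord0 = 1 :> 'I_4 by exact/val_inj.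
have E2 : lift ord0 (lift ord0 ord0) = 2 :> 'I_4 by exact/val_inj.
have E3 : lift ord0 (lift ord0 (lift ord0 ord0)) = 3 :> 'I_4 by exact/val_inj.
by rewrite E1 E2 E3 (_ : ord0 = 0) //; ring.
Qed.

Lemma row4P (u v : V) :
  u 0 0 = v 0 0 -> u 0 1 = v 0 1 -> u 0 2 = v 0 2 -> u 0 3 = v 0 3 -> u = v.
Proof.
move=> h0 h1 h2 h3; apply/rowP => -[[|[|[|[|//]]]] i].
- by rewrite (_ : Ordinal i = 0) //; exact/val_inj.
- by rewrite (_ : Ordinal i = 1) //; exact/val_inj.
- by rewrite (_ : Ordinal i = 2) //; exact/val_inj.
- by rewrite (_ : Ordinal i = 3) //; exact/val_inj.
Qed.

Lemma S01_ip_inj (u v : V) : (forall w, S01_ip u w = S01_ip v w) -> u = v.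
Proof.
move=> h; apply: row4P.
- by have := h (e 0); rewrite !S01_ipE !mxE /= !(mulr0, mulr1, addr0, add0r).
- by have := h (e 1); rewrite !S01_ipE !mxE /= !(mulr0, mulr1, addr0, add0r).
- by have := h (e 3); rewrite !S01_ipE !mxE /= !(mulr0, mulr1, addr0, add0r).
- by have := h (e 2); rewrite !S01_ipE !mxE /= !(mulr0, mulr1, addr0, add0r).
Qed.

Lemma vframe_orthonormal (i j : 'I_4) :
  S01_ip (vframe i) (vframe j)
  = if i == j then (if i == 3 then -1 else 1) else 0.
Proof.
have s2 : (Num.sqrt 2)^-1 ^+ 2 = 2^-1 :> R by rewrite exprVn sqr_sqrtr.
have s2' : (Num.sqrt 2)^-1 * (Num.sqrt 2)^-1 = 2^-1 :> R by rewrite -expr2.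
have h : 2^-1 + 2^-1 = 1 :> R by field.
rewrite S01_ipE /vframe.
case: i => -[|[|[|[|//]]]] ?; case: j => -[|[|[|[|//]]]] ? /=;
  rewrite !mxE /= ?(mulr0, mul0r, mulr1, mul1r, addr0, add0r, subr0, sub0r,
                    mulrN, mulNr, opprK, s2', h) //.
all: by rewrite ?oppr0 ?add0r ?subrr ?addNr // -opprD h.
Qed.

Let sharp (f : V -> R) : V :=
  f (e 0) *: e 0 + f (e 1) *: e 1 + f (e 3) *: e 2 + f (e 2) *: e 3.

Let sharpP (f : V -> R) (v : V) :
  (forall a x y, f (a *: x + y) = a * f x + f y) -> S01_ip (sharp f) v = f v.
Proof.
move=> fl; have f0 : f 0 = 0.
  by have := fl (-1) 0 0; rewrite scaler0 addr0 mulN1r addNr.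
have -> : f v = f (v 0 0 *: e 0 + (v 0 1 *: e 1
                   + (v 0 2 *: e 2 + (v 0 3 *: e 3 + 0)))).
  by congr f; apply: row4P; rewrite !mxE /=; ring.
by rewrite !fl f0 S01_ipE !mxE /=; ring.
Qed.

Lemma levi_civita_exists : exists nabla, levi_civita h3R_br S01_ip nabla.
Proof.
exists (fun u v => sharp (fun w => 2^-1 * (S01_ip (h3R_br u v) w
  + S01_ip (h3R_br w u) v + S01_ip (h3R_br w v) u))).
move=> u v w; rewrite sharpP => [|a x y].
  by rewrite mulrA mulfV ?mul1r ?pnatr_eq0.
by rewrite mulrCA -mulrDr; congr (_ * _); rewrite !S01_ipE !mxE /=; ring.
Qed.

Lemma levi_civita_unique (nabla nabla' : V -> V -> V) :
  levi_civita h3R_br S01_ip nabla -> levi_civita h3R_br S01_ip nabla' ->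
  forall u v, nabla u v = nabla' u v.
Proof.
move=> h h' u v; apply: S01_ip_inj => w.
have n2 : 2 != 0 :> R by rewrite pnatr_eq0.
by apply: (mulfI n2); rewrite h h'.
Qed.

Lemma product_structure_exists : exists J, is_product_structure J.
Proof.
exists (mulmxr S01).
have hS (i j : 'I_4) : (e i *m S01) 0 j = S01 i j.
  by rewrite /e -rowE mxE.
have E0 : e 0 *m S01 = e 0 by apply: row4P; rewrite hS !mxE.
have E1 : e 1 *m S01 = e 1 by apply: row4P; rewrite hS !mxE.
have E2 : e 2 *m S01 = e 3 by apply: row4P; rewrite hS !mxE.
have E3 : e 3 *m S01 = e 2 by apply: row4P; rewrite hS !mxE.
split; rewrite /vframe /mulmxr /= ?E0 ?E1 //.
- by rewrite -scalemxAl mulmxDl E2 E3 addrC.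
- by rewrite -scalemxAl mulmxBl E2 E3 -scalerN opprB.
Qed.

Lemma KN_Ric_sym_exists (J : {linear V -> V}) (nabla : V -> V -> V) :
  levi_civita h3R_br S01_ip nabla ->
  exists T, is_KN_Ric_sym h3R_br S01_ip J nabla vframe T.
Proof.
move=> hn.
have n2 : 2 != 0 :> R by rewrite pnatr_eq0.
have ipl a x y z : S01_ip (a *: x + y) z = a * S01_ip x z + S01_ip y z.
  by rewrite !S01_ipE !mxE; ring.
have brr a x y z : h3R_br z (a *: x + y) = a *: h3R_br z x + h3R_br z y.
  by apply/rowP => i; rewrite !mxE; ring.
have nl a x y z : nabla (a *: x + y) z = a *: nabla x z + nabla y z.
  apply: S01_ip_inj => w; apply: (mulfI n2).
  by rewrite ipl mulrDr mulrCA !hn !S01_ipE !mxE; ring.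
have nr a x y z : nabla z (a *: x + y) = a *: nabla z x + nabla z y.
  apply: S01_ip_inj => w; apply: (mulfI n2).
  by rewrite ipl mulrDr mulrCA !hn !S01_ipE !mxE; ring.
have Jl a x y : J (a *: x + y) = a *: J x + J y by exact: linearP.
have jl a x y z :
    nablaJ J nabla (a *: x + y) z = a *: nablaJ J nabla x z + nablaJ J nabla y z.
  by rewrite /nablaJ !nl Jl; apply/rowP => i; rewrite !mxE; ring.
have jr a x y z :
    nablaJ J nabla z (a *: x + y) = a *: nablaJ J nabla z x + nablaJ J nabla z y.
  by rewrite /nablaJ !(Jl, nr); apply/rowP => i; rewrite !mxE; ring.
pose N := kobayashi_nomizu_conn J nabla.
have Nl a x y z : N (a *: x + y) z = a *: N x z + N y z.
  rewrite /N /kobayashi_nomizu_conn /canonical_conn !(Jl, nl, jl, jr).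
  by apply/rowP => i; rewrite !mxE; ring.
have Nr a x y z : N z (a *: x + y) = a *: N z x + N z y.
  rewrite /N /kobayashi_nomizu_conn /canonical_conn !(Jl, nr, jl, jr).
  by apply/rowP => i; rewrite !mxE; ring.
pose Ric := KN_Ric h3R_br S01_ip J nabla vframe.
have Ricl a x y : Ric (a *: x + y) = a *: Ric x + Ric y.
  rewrite /Ric /KN_Ric scaler_sumr -big_split; apply: eq_bigr => k _ /=.
  rewrite /KN_curvature -/N; move: (N) Nl Nr => N' Nl Nr.
  by rewrite !(brr, Nl, Nr); apply/rowP => i; rewrite !mxE; ring.
pose rhoS := KN_rho_sym h3R_br S01_ip J nabla vframe.
have rhoSr a x y z : rhoS z (a *: x + y) = a * rhoS z x + rhoS z y.
  rewrite /rhoS /KN_rho_sym /KN_rho -/Ric.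
  move: (Ric) Ricl => Ric' Ricl.
  by rewrite Ricl ipl !S01_ipE !mxE; ring.
by exists (fun u => sharp (rhoS u)) => u v; rewrite sharpP.
Qed.

End H3R.

(* Main.v *)
Require Import Defs.
From mathcomp Require Import all_boot all_order all_algebra.
From mathcomp Require Import reals.
From mathcomp Require Import ring lra.
Import Order.TTheory GRing.Theory Num.Theory.
Local Open Scope ring_scope.

(** A derivation [D] preserves the derived algebra, which is spanned by [e 2],
    and [e 2] is null, so [c *: e 2 + D (e 2)] is orthogonal to [e 2]. Both
    $\rho^1$ and $\widetilde\rho^1$, however, take the value $1/8$ at the pair
    ([e 2], [e 2]). *)

(* Locked so that [mxE] and the rewrite rules below do not see through it. *)
Definition row4 {R : realType} (a b c d : R) : 'rV[R]_4 :=
  locked (a *: e 0 + b *: e 1 + c *: e 2 + d *: e 3).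

Lemma row4E {R : realType} (a b c d : R) :
  (row4 a b c d 0 0 = a) * (row4 a b c d 0 1 = b) *
  (row4 a b c d 0 2 = c) * (row4 a b c d 0 3 = d).
Proof. by do !split; rewrite /row4 -lock /e !mxE /=; ring. Qed.

Lemma row4_coord {R : realType} (u : 'rV[R]_4) :
  u = row4 (u 0 0) (u 0 1) (u 0 2) (u 0 3).
Proof. by apply: row4P; rewrite row4E. Qed.

Lemma row4D {R : realType} (a b c d a' b' c' d' : R) :
  row4 a b c d + row4 a' b' c' d' = row4 (a + a') (b + b') (c + c') (d + d').
Proof. by apply: row4P; rewrite mxE !row4E. Qed.

Lemma row4Z {R : realType} (k a b c d : R) :
  k *: row4 a b c d = row4 (k * a) (k * b) (k * c) (k * d).
Proof. by apply: row4P; rewrite mxE !row4E. Qed.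

Lemma row4N {R : realType} (a b c d : R) :
  - row4 a b c d = row4 (- a) (- b) (- c) (- d).
Proof. by apply: row4P; rewrite mxE !row4E. Qed.

Lemma e_row4 {R : realType} :
  (e 0 = row4 1 0 0 0 :> 'rV[R]_4) * (e 1 = row4 0 1 0 0 :> 'rV[R]_4) *
  (e 2 = row4 0 0 1 0 :> 'rV[R]_4) * (e 3 = row4 0 0 0 1 :> 'rV[R]_4).
Proof. by do !split; apply: row4P; rewrite row4E mxE. Qed.

Lemma h3R_br_row4 (R : realType) (a b c d a' b' c' d' : R) :
  h3R_br (row4 a b c d) (row4 a' b' c' d') = row4 0 0 (a * b' - b * a') 0.
Proof. by rewrite /h3R_br e_row4 row4Z !row4E !mulr0 mulr1. Qed.

(** Fixing [e 2 + e 3] and negating [e 2 - e 3] forces [J] to swap [e 2] and [e 3]. *)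
Lemma product_structureE (R : realType) (J : {linear 'rV[R]_4 -> 'rV[R]_4}) :
  is_product_structure J ->
  forall u, J u = row4 (u 0 0) (u 0 1) (u 0 3) (u 0 2).
Proof.
rewrite /is_product_structure /vframe /= => -[J0 J1 Jp Jm] u.
have q0 : (Num.sqrt 2)^-1 != 0 :> R.
  by rewrite invr_eq0 gt_eqF // sqrtr_gt0 ltr0n.
move: Jp Jm; rewrite !linearZ /=.
move=> /(scalerI q0); rewrite linearD => Jp.
move=> /(scalerI q0); rewrite linearB => Jm.
have coord k : J (e 2) 0 k = e 3 0 k /\ J (e 3) 0 k = e 2 0 k :> R.
  move/rowP/(_ k): Jp; move/rowP/(_ k): Jm; rewrite !mxE => ? ?.
  by split; lra.
have J2 : J (e 2) = e 3 by apply/rowP => k; have [] := coord k.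
have J3 : J (e 3) = e 2 by apply/rowP => k; have [] := coord k.
rewrite {1}(row4_coord u) /row4 -!lock !linearD !linearZ /= J0 J1 J2 J3.
by rewrite -!addrA; congr (_ + (_ + _)); rewrite addrC.
Qed.

(** By non-degeneracy it is enough to pair both sides with every [w] and apply Koszul's formula. The
    last coordinate is the pairing with [e 2], which vanishes since [e 2] is central and null. *)
Lemma levi_civitaE (R : realType) (nabla : 'rV[R]_4 -> 'rV[R]_4 -> 'rV[R]_4) :
  levi_civita h3R_br S01_ip nabla ->
  forall u v, nabla u v =
    row4 (2^-1 * (u 0 1 * v 0 3 + v 0 1 * u 0 3))
         (- 2^-1 * (u 0 0 * v 0 3 + v 0 0 * u 0 3))
         (2^-1 * (u 0 0 * v 0 1 - u 0 1 * v 0 0)) 0.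
Proof.
move=> hn u v; apply: S01_ip_inj => w.
have n2 : 2 != 0 :> R by rewrite pnatr_eq0.
apply: (mulfI n2); rewrite hn !S01_ipE.
rewrite !row4E.
by rewrite !mxE /=; field.
Qed.

(** The closed form that turns the curvature into a computation by rewriting. It vanishes on pairs
    from the span of [e 2] and [e 3]. *)
Lemma kobayashi_nomizu_row4 (R : realType)
    (J : {linear 'rV[R]_4 -> 'rV[R]_4})
    (nabla : 'rV[R]_4 -> 'rV[R]_4 -> 'rV[R]_4) :
  is_product_structure J -> levi_civita h3R_br S01_ip nabla ->
  forall a b c d a' b' c' d',
  kobayashi_nomizu_conn J nabla (row4 a b c d) (row4 a' b' c' d') =
    row4 (4^-1 * (b * (c' + d') + b' * (c + d)))
         (- 4^-1 * (a * (c' + d') + a' * (c + d)))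
         (4^-1 * (a * b' - b * a')) (4^-1 * (a * b' - b * a')).
Proof.
move=> hJ hn *; rewrite /kobayashi_nomizu_conn /canonical_conn /nablaJ.
rewrite !(product_structureE _ _ hJ, levi_civitaE _ _ hn, row4E).
rewrite !(row4Z, row4N, row4D).
by apply: row4P; rewrite !row4E; field.
Qed.

(** Each of [vframe 0] and [vframe 1] contributes $\frac1{16}(e_3+e_4)$ to the Ricci operator at
    [e 2]; the other two frame vectors contribute zero. *)
Lemma KN_rho_e2e2 (R : realType) (J : {linear 'rV[R]_4 -> 'rV[R]_4})
    (nabla : 'rV[R]_4 -> 'rV[R]_4 -> 'rV[R]_4) :
  is_product_structure J -> levi_civita h3R_br S01_ip nabla ->
  KN_rho h3R_br S01_ip J nabla vframe (e 2) (e 2) = 8^-1.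
Proof.
move=> hJ hn; rewrite /KN_rho /KN_Ric.
under eq_bigr => k _ do rewrite vframe_orthonormal eqxx.
rewrite !big_ord_recl big_ord0 /vframe /= /KN_curvature.
move: (kobayashi_nomizu_conn J nabla) (kobayashi_nomizu_row4 _ _ _ hJ hn) => N NE.
(* The terms containing [q] vanish identically, so [q] can be an arbitrary scalar. *)
rewrite !e_row4 S01_ipE; move: (Num.sqrt 2)^-1 => q.
rewrite !(row4Z, row4N, row4D, addr0) !(NE, h3R_br_row4).
by rewrite !(row4Z, row4N, row4D) !row4E; field.
Qed.

Lemma soliton_ip_e2 (R : realType) (D : {linear 'rV[R]_4 -> 'rV[R]_4}) (c : R) :
  derivation h3R_br D -> S01_ip (c *: e 2 + D (e 2)) (e 2) = 0.
Proof.
(* Since [e 2] is the bracket of [e 0] and [e 1], the Leibniz rule writes [D (e 2)] as a sum of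
   brackets. *)
move=> hD; have := hD (e 0) (e 1); rewrite h3R_br_basis /= => <-.
by rewrite S01_ipE !mxE /=; ring.
Qed.

Theorem theorem4p8 (R : realType) (J : {linear 'rV[R]_4 -> 'rV[R]_4})
    (nabla : 'rV[R]_4 -> 'rV[R]_4 -> 'rV[R]_4)
    (hJ : is_product_structure J)
    (hnabla : levi_civita h3R_br S01_ip nabla) :
  ~ first_kind_soliton h3R_br S01_ip J nabla vframe /\
  ~ second_kind_soliton h3R_br S01_ip J nabla vframe.
Proof.
have rho_e2 := KN_rho_e2e2 _ _ _ hJ hnabla.
split=> [[c [D [hD hRic]]] | [T [hT [c [D [hD hTD]]]]]].
- have := rho_e2; rewrite /KN_rho hRic soliton_ip_e2 // => ?; lra.
- have := hT (e 2) (e 2).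
  (* On the diagonal the symmetrization agrees with $\rho^1$, so again $1/8=0$. *)
  by rewrite hTD soliton_ip_e2 // /KN_rho_sym rho_e2 => ?; lra.
Qed.
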